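(* There exists a constant $c<2.1652$ such that the following holds. Let $z\in\Omega_2$ and let $z'\in\Gamma_z$ be in the orbit of $z$, and let $\gamma$ and $\gamma'$ be the largest interior angles of the triangles defined by $z$ and $z'$, respectively. Then $\gamma'\leq c\,\gamma$.
   Context: Space of triangles: $\Sigma = \{ z\in\mathbb{C} : \operatorname{Im}(z) > 0,\ \operatorname{Re}(z)\leq 1/2,\ |z-1|\leq 1\}$. A point $z\in\Sigma$ defines the triangle with vertices $0$, $1$, $z$; here the segment from $0$ to $1$ is a longest edge and the segment from $0$ to $z$ is a shortest edge. Every nondegenerate triangle is similar (orientation-reversing similarities allowed) to the triangle defined by exactly one $w\in\Sigma$, called its normalized form. Longest edge trisection (LE3): the longest edge is divided into three equal parts and the two division points are joined to the opposite vertex. For $z\in\Sigma$ this gives the left triangle with vertices $0,\tfrac13,z$, the middle triangle with vertices $\tfrac13,\tfrac23,z$ and the right triangle with vertices $\tfrac23,1,z$. Let $W_{\mathrm L}(z), W_{\mathrm M}(z), W_{\mathrm R}(z)\in\Sigma$ be the normalized forms of the left, middle and right triangle, respectively. The orbit $\Gamma_z$ of $z$ is the smallest subset of $\Sigma$ that contains $z$ and is closed under $W_{\mathrm L}, W_{\mathrm M}, W_{\mathrm R}$. Hyperbolic metric: the upper half-plane $\{\operatorname{Im} z>0\}$ carries the Poincaré metric, whose distance $d$ is given by $\cosh d(z_1,z_2)= 1+\frac{|z_1-z_2|^2}{2\operatorname{Im}(z_1)\operatorname{Im}(z_2)}$. Circles: let $\omega_1=\frac13+\frac{\sqrt2}{3}i$,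 $\omega_2=\frac13+\frac{\sqrt2}{6}i$, $\omega_3=\frac49+\frac{\sqrt2}{9}i$. For $j=1,2,3$ let $C_j$ be the hyperbolic circle with hyperbolic centre $\omega_j$ and hyperbolic radius $\ln(\sqrt2)$, and let $D_j=\{z: d(z,\omega_j)\le \ln\sqrt2\}$ be the closed disc it bounds. The region $\Omega_2$: this is the region in $\Sigma$ under the circles $C_1$, $C_2$ and $C_3$, i.e. the connected component of $\Sigma\setminus(D_1\cup D_2\cup D_3)$ whose closure in $\mathbb{C}$ meets the real axis. (The discs form a chain of successively tangent discs, from the arc $|z-1|=1$, through $D_1$, $D_2$, $D_3$, to the line $\operatorname{Re} z=1/2$, so this component is well defined.) *)

(* Defs.v *)
From HB Require Import structures.
From mathcomp Require Import all_boot all_order all_algebra.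
From mathcomp Require Import complex.
From mathcomp Require Import all_classical all_reals all_analysis.
From mathcomp Require Import ring.

Set Implicit Arguments.
Unset Strict Implicit.
Unset Printing Implicit Defensive.

Import Order.TTheory GRing.Theory Num.Theory.
Import numFieldNormedType.Exports.
Import ComplexField.Normc.

Local Open Scope classical_set_scope.
Local Open Scope ring_scope.

Section Triangles.
Context {R : realType}.
Implicit Types (p q r z w : R[i]) (T : set R[i]).

(* [normc] is the modulus as an element of R; the norm `|z| of R[i] takes its
   values in R[i]. *)

Definition Sigma : set R[i] :=
  [set z | [/\ 0 < complex.Im z, complex.Re z <= 1 / 2 & normc (z - 1) <= 1]].

(* Similarities of the plane, orientation-reversing ones included. *)
Definition similarity (f : R[i] -> R[i]) : Prop :=
  exists2 k : R, 0 < k & forall x y, normc (f x - f y) = k * normc (x - y).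

(* A triangle is given by its (unordered) set of vertices. *)
Definition similar_triangles (T T' : set R[i]) : Prop :=
  exists2 f : R[i] -> R[i], similarity f & f @` T = T'.

Definition triangle z : set R[i] := [set 0; 1; z].

(* For a nondegenerate triangle there is exactly one such w; the default value
   0 of [xget] is only reached for degenerate ones. *)
Definition normalized_form T : R[i] :=
  xget 0 [set w | Sigma w /\ similar_triangles T (triangle w)].

Definition W_L z : R[i] := normalized_form [set 0; 1 / 3; z].
Definition W_M z : R[i] := normalized_form [set 1 / 3; 2 / 3; z].
Definition W_R z : R[i] := normalized_form [set 2 / 3; 1; z].

Definition LE3_closed (S : set R[i]) : Prop :=
  forall w, S w -> [/\ S (W_L w), S (W_M w) & S (W_R w)].

Definition LE3_orbit z : set R[i] :=
  smallest [set S | S `<=` Sigma /\ LE3_closed S] [set z].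

(* Interior angle at the vertex p of the triangle p q r. *)
Definition angle p q r : R :=
  acos (complex.Re ((q - p) * ((r - p)^*)%C) / (normc (q - p) * normc (r - p))).

Definition largest_angle z : R :=
  Num.max (angle 0 1 z) (Num.max (angle 1 0 z) (angle z 0 1)).

Definition cosh (x : R) : R := (expR x + expR (- x)) / 2.
Definition arcosh (x : R) : R := ln (x + Num.sqrt (x ^+ 2 - 1)).

Definition hdist z1 z2 : R :=
  arcosh (1 + normc (z1 - z2) ^+ 2 / (2 * complex.Im z1 * complex.Im z2)).

Lemma arcosh_ge0 (x : R) : 1 <= x -> 0 <= arcosh x.
Proof.
by move=> x1; rewrite ln_ge0// (le_trans x1)// lerDl sqrtr_ge0.
Qed.

Lemma arcoshK (x : R) : 1 <= x -> cosh (arcosh x) = x.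
Proof.
move=> x1; rewrite /cosh /arcosh; set s := Num.sqrt _.
have s0 : 0 <= s by exact: sqrtr_ge0.
have s2 : s ^+ 2 = x ^+ 2 - 1 by rewrite sqr_sqrtr// subr_ge0 expr_ge1// (le_trans ler01).
have xs0 : 0 < x + s by rewrite ltr_pwDl// (lt_le_trans ltr01).
rewrite expRN lnK ?posrE//.
have -> : (x + s)^-1 = x - s.
  by apply: (mulfI (lt0r_neq0 xs0)); rewrite divff ?gt_eqF// mulrC -subr_sqr s2; ring.
by field.
Qed.

(* [hdist] is the nonnegative number determined by the formula for cosh. *)
Lemma hdist_ge0 z1 z2 : 0 < complex.Im z1 -> 0 < complex.Im z2 -> 0 <= hdist z1 z2.
Proof.
by move=> h1 h2; rewrite arcosh_ge0// lerDl divr_ge0 ?sqr_ge0// !mulr_ge0 ?ltW.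
Qed.

Lemma cosh_hdist z1 z2 : 0 < complex.Im z1 -> 0 < complex.Im z2 ->
  cosh (hdist z1 z2) = 1 + normc (z1 - z2) ^+ 2 / (2 * complex.Im z1 * complex.Im z2).
Proof.
by move=> h1 h2; rewrite arcoshK// lerDl divr_ge0 ?sqr_ge0// !mulr_ge0 ?ltW.
Qed.

Definition omega1 : R[i] := ((1 / 3) +i* (Num.sqrt 2 / 3))%C.
Definition omega2 : R[i] := ((1 / 3) +i* (Num.sqrt 2 / 6))%C.
Definition omega3 : R[i] := ((4 / 9) +i* (Num.sqrt 2 / 9))%C.

Definition hdisc (omega : R[i]) : set R[i] :=
  [set z | 0 < complex.Im z /\ hdist z omega <= ln (Num.sqrt 2)].

Definition real_axis : set R[i] := [set z | complex.Im z = 0].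

Definition Sigma_minus_discs : set R[i] :=
  Sigma `\` (hdisc omega1 `|` hdisc omega2 `|` hdisc omega3).

(* The points whose connected component in [Sigma_minus_discs] has a closure
   that meets the real axis.  The canonical topology of the field R[i], i.e.
   the Euclidean one, is carried by its alias (R[i])^o. *)
Definition Omega2 : set R[i] :=
  [set z | Sigma_minus_discs z /\
    closure (connected_component (Sigma_minus_discs : set (R[i])^o) z)
      `&` real_axis !=set0].

End Triangles.

(* Main.v *)
Require Import Defs.
From mathcomp Require Import all_boot all_order all_algebra.
From mathcomp Require Import complex.
From mathcomp Require Import all_classical all_reals all_analysis.
From mathcomp Require Import ring lra.
Set Implicit Arguments.
Unset Strict Implicit.
Unset Printing Implicit Defensive.
Import Order.TTheory GRing.Theory Num.Theory.
Import numFieldNormedType.Exports.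
Import ComplexField.Normc.
Local Open Scope classical_set_scope.
Local Open Scope ring_scope.

(** Write gamma for the largest angle of the triangle [z], which for [z] in [Sigma] is
    the angle at the apex [z].

    Normalizing a triangle on a given base folds the upper half-plane onto the domain
    [Sigma] by hyperbolic reflections, and passing from the base 0, 1 to one of the
    three pieces of it is a hyperbolic isometry. Hence [W_L], [W_M] and [W_R] do not
    increase hyperbolic distances ([fold_contraction]). The centres omega1, omega2,
    omega3 are carried into each other by these maps ([omega_trisection]), so no point of
    the orbit of [z] is farther from the set of centres than [z] is from omega1
    ([orbit_near_omega]).

    The cotangent of gamma is the hyperbolic sine of the signed distance to the geodesic
    from 0 to 1, and the distance itself is 1-Lipschitz. The centres have cotangents 0,
    -1/sqrt 2 and -sqrt 2, so a bound on the distance to the centres bounds the apex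
    angle away from pi ([cotz_lower_bound]).

    If gamma is at least pi/2, the bound gamma' <= pi <= c gamma is trivial. The other
    points of [Omega2] lie between the arc |z - 1| = 1, the first circle and the
    semicircle with diameter from 0 to 1. There k = cot gamma lies between 0 and
    1/3, and the distance of [z] to omega1 is bounded in terms of k ([below_cotz]). This
    gives gamma' <= pi - arctan (sqrt 2 k), which is at most
    2.165 (pi/2 - arctan k) = 2.165 gamma ([angle_ratio]). The extreme case is the
    point 1/5 + 3i/5 where the first circle touches the arc, with k = 1/3.

    That [Omega2] lies below the chain of discs is seen from a broken line contained in
    the discs, which separates [Sigma] minus the discs into two relatively open parts
    ([Omega2_below]). *)

Section LongestEdgeTrisection.
Context {R : realType}.
Implicit Types (p q r z w o v : R[i]) (k l c : R).

(** * Coordinates *)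

Lemma sqrt2_sq : Num.sqrt 2 ^+ 2 = 2 :> R.
Proof. by rewrite sqr_sqrtr. Qed.

Lemma sqrt2_gt0 : 0 < Num.sqrt 2 :> R.
Proof. by rewrite sqrtr_gt0. Qed.

Lemma sqr_le_sqr (u b : R) : - b <= u <= b -> u ^+ 2 <= b ^+ 2.
Proof.
move=> /andP[h1 h2]; have : 0 <= (b - u) * (b + u) by rewrite mulr_ge0; lra.
by lra.
Qed.

Lemma normc_ge0 z : 0 <= normc z.
Proof. by case: z => a b; exact: sqrtr_ge0. Qed.

Lemma normc_gt0 z : (0 < normc z) = (z != 0).
Proof.
rewrite lt0r normc_ge0 andbT; congr negb.
by apply/eqP/eqP => [/eq0_normc|->]; rewrite ?normc0.
Qed.

Definition sqdist p q : R := normc (p - q) ^+ 2.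

Lemma sqdistE p q : sqdist p q =
  (complex.Re p - complex.Re q) ^+ 2 + (complex.Im p - complex.Im q) ^+ 2.
Proof.
case: p q => [a b] [c d]; rewrite /sqdist /= sqr_sqrtr//.
by rewrite addr_ge0 ?sqr_ge0.
Qed.

Lemma sqdistC p q : sqdist p q = sqdist q p.
Proof. by rewrite !sqdistE -sqrrN opprB -(sqrrN (_ - complex.Im q)) opprB. Qed.

Lemma sqdist_ge0 p q : 0 <= sqdist p q.
Proof. exact: sqr_ge0. Qed.

Lemma SigmaE z : Sigma z <->
  [/\ 0 < complex.Im z, complex.Re z <= 1 / 2 & sqdist z 1 <= 1].
Proof.
by rewrite /sqdist -[X in _ ^+ 2 <= X](expr1n _ 2) ler_sqr ?nnegrE ?normc_ge0.
Qed.

Lemma Re_third n : complex.Re (n%:R / 3 : R[i]) = n%:R / 3.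
Proof.
have -> : (n%:R / 3 : R[i]) = (n%:R / 3)%:C%C by rewrite fmorph_div !rmorph_nat.
by [].
Qed.

Lemma Im_third n : complex.Im (n%:R / 3 : R[i]) = 0.
Proof.
have -> : (n%:R / 3 : R[i]) = (n%:R / 3)%:C%C by rewrite fmorph_div !rmorph_nat.
by [].
Qed.

(** * Sides of triangles and hyperbolic contraction *)

(** Sides are listed by their end points at [r], so that for the triangle
    [0, 1, w] with [w] in [Sigma] the list is increasing. *)
Definition sqsides p q r : seq R := [:: sqdist r p; sqdist q r; sqdist p q].

(** All that is used of the similarity of two triangles: being invariant under
    relabelling, it does not see which vertex goes where. *)
Definition proportional_sides p q r w :=
  exists2 k, 0 < k & perm_eq (sqsides 0 1 w) [seq k * x | x <- sqsides p q r].

Lemma perm3P (T : eqType) (x y z x' y' z' : T) :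
  perm_eq [:: x; y; z] [:: x'; y'; z'] ->
  [\/ [/\ x = x', y = y' & z = z'], [/\ x = x', y = z' & z = y'] |
   [\/ [/\ x = y', y = x' & z = z'], [/\ x = y', y = z' & z = x'],
       [/\ x = z', y = x' & z = y'] | [/\ x = z', y = y' & z = x']]].
Proof.
move=> /(perm_iotaP x')[I]; rewrite -mem_permutations => hI eI.
have {hI} : I \in [:: [:: 1; 0; 2]; [:: 0; 1; 2]; [:: 2; 0; 1]; [:: 0; 2; 1];
    [:: 1; 2; 0]; [:: 2; 1; 0]]%N.
  rewrite (_ : [:: [:: 1; 0; 2]; _; _; _; _; _]%N = permutations (iota 0 3)); last by vm_compute.
  exact: hI.
rewrite !inE => h; move: eI.
case/or4P: h => [| | |/or3P[]] /eqP-> [-> -> ->].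
- by apply: Or33; apply: Or41.
- exact: Or31.
- by apply: Or33; apply: Or43.
- exact: Or32.
- by apply: Or33; apply: Or42.
- by apply: Or33; apply: Or44.
Qed.

Lemma similar_proportional p q r w : 0 < complex.Im w ->
  similar_triangles [set p; q; r] (triangle w) -> proportional_sides p q r w.
Proof.
move=> w0 [f [k k0 fk] fT].
have sqf x y : sqdist (f x) (f y) = k ^+ 2 * sqdist x y by rewrite /sqdist fk exprMn.
have pre x : triangle w x -> exists2 y, y \in [:: p; q; r] & f y = x.
  rewrite -fT => -[y Ty <-]; exists y => //; rewrite !inE.
  by case: Ty => [[]|] /= ->; rewrite eqxx ?orbT.
have /= [p1 p1T fp] := pre 0 (or_introl (or_introl erefl)).
have /= [q1 q1T fq] := pre 1 (or_introl (or_intror erefl)).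
have /= [r1 r1T fr] := pre w (or_intror erefl).
have w01 x : complex.Im x = 0 -> x != w.
  by move=> x0; apply: contraTN w0 => /eqP <-; rewrite x0 ltxx.
have uni : uniq [:: p1; q1; r1].
  have neq x y : f x != f y -> x != y by apply: contra => /eqP ->.
  have pq : p1 != q1 by apply: neq; rewrite fp fq eq_sym oner_neq0.
  have pr : p1 != r1 by apply: neq; rewrite fp fr w01.
  have qr : q1 != r1 by apply: neq; rewrite fq fr w01.
  by rewrite /= !inE negb_or pq pr qr.
(* The preimages of [0, 1, w] are three distinct points among [p, q, r], hence a
   permutation of them. *)
have sub : {subset [:: p1; q1; r1] <= [:: p; q; r]}.
  by apply/allP; rewrite /= p1T q1T r1T.
have uni' : uniq [:: p; q; r] by exact: leq_size_uniq sub _.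
have [_ mem] := uniq_min_size uni sub isT.
have pqr := uniq_perm uni uni' mem.
exists (k ^+ 2); first exact: exprn_gt0.
rewrite /sqsides /= -fp -fq -fr !sqf.
have -> : [:: k ^+ 2 * sqdist r1 p1; k ^+ 2 * sqdist q1 r1; k ^+ 2 * sqdist p1 q1]
   = [seq k ^+ 2 * x | x <- sqsides p1 q1 r1] by [].
apply: (@perm_map _ _ _ (sqsides p1 q1 r1) (sqsides p q r)).
rewrite /sqsides.
case: (perm3P pqr) => [[-> -> ->]|[-> -> ->]|[] [-> -> ->]] //;
  apply/permP => P /=; rewrite ?(sqdistC q p) ?(sqdistC r q) ?(sqdistC p r);
  by do 3 case: (P _).
Qed.

(** Pedoe's bilinear form: on two copies of a triangle it is 16 times the square
    of the area. *)
Definition pedoe (s t : seq R) : R :=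
  (\sum_(x <- s) x) * (\sum_(y <- t) y) - 2 * \sum_(u <- zip s t) u.1 * u.2.

(** The hyperbolic cosine of [hdist], which is all that the argument needs of
    the distance. *)
Definition coshd z w : R :=
  1 + sqdist z w / (2 * complex.Im z * complex.Im w).

(** For triangles on a common base the Pedoe form depends on the hyperbolic
    distance of the apexes. This turns the folding of the half-plane onto
    [Sigma] into a relabelling of sides. *)
Lemma pedoe_sides p q z w : complex.Im p = 0 -> complex.Im q = 0 ->
  0 < complex.Im z -> 0 < complex.Im w ->
  pedoe (sqsides p q z) (sqsides p q w) =
  4 * sqdist p q * complex.Im z * complex.Im w * coshd z w.
Proof.
move=> p0 q0 z0 w0; rewrite /pedoe /sqsides /= !big_cons !big_nil /= /coshd.
rewrite !sqdistE p0 q0; field.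
by rewrite !gt_eqF.
Qed.

Lemma coshdii z : coshd z z = 1.
Proof. by rewrite /coshd sqdistE !subrr expr0n /= addr0 mul0r addr0. Qed.

Lemma pedoe_scale k l s t :
  pedoe [seq k * x | x <- s] [seq l * x | x <- t] = k * l * pedoe s t.
Proof.
rewrite /pedoe !big_map -!mulr_sumr.
have -> : \sum_(u <- zip [seq k * x | x <- s] [seq l * x | x <- t]) u.1 * u.2
  = k * l * \sum_(u <- zip s t) u.1 * u.2.
  elim: s t => [|x s IH] [|y t] /=; rewrite ?big_nil ?mulr0 // !big_cons IH /=.
  ring.
ring.
Qed.

Lemma pedoe_perm (s t : seq R) : perm_eq s t -> pedoe s s = pedoe t t.
Proof.
move=> st; rewrite /pedoe !(perm_big _ st) /=; congr (_ - 2 * _).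
have zz (r : seq R) : \sum_(u <- zip r r) u.1 * u.2 = \sum_(x <- r) x * x.
  by elim: r => [|x r IH] /=; rewrite ?big_nil // !big_cons IH.
by rewrite !zz (perm_big _ st).
Qed.

(** The rearrangement inequality for three terms: the difference of the two sides
    is a nonnegative combination of the four products below. *)
Lemma rearrangement (a b c a' b' c' x y z x' y' z' : R) :
  a <= b <= c -> a' <= b' <= c' ->
  perm_eq [:: a; b; c] [:: x; y; z] -> perm_eq [:: a'; b'; c'] [:: x'; y'; z'] ->
  x * x' + y * y' + z * z' <= a * a' + b * b' + c * c'.
Proof.
move=> /andP[ab bc] /andP[ab' bc'].
have h1 : 0 <= (b - a) * (b' - a') by rewrite mulr_ge0 ?subr_ge0.
have h2 : 0 <= (c - b) * (b' - a') by rewrite mulr_ge0 ?subr_ge0.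
have h3 : 0 <= (b - a) * (c' - b') by rewrite mulr_ge0 ?subr_ge0.
have h4 : 0 <= (c - b) * (c' - b') by rewrite mulr_ge0 ?subr_ge0.
move=> /perm3P p /perm3P p'.
by case: p => [[? ? ?]|[? ? ?]|[][? ? ?]]; case: p' => [[? ? ?]|[? ? ?]|[][? ? ?]];
  subst; lra.
Qed.

Lemma Sigma_sides w : Sigma w ->
  sqdist w 0 <= sqdist 1 w <= sqdist 0 1 /\ sqdist 0 1 = 1.
Proof.
move=> /SigmaE[y0 x2 n1].
have e : sqdist 0 1 = 1 by rewrite sqdistE /=; ring.
split=> //; rewrite e (sqdistC 1 w) n1 andbT !sqdistE /=; lra.
Qed.

(** Compare areas: the Pedoe form of a triangle with itself is symmetric in its
    sides and quadratic in the scale. *)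
Lemma proportional_Im p q z w : complex.Im p = 0 -> complex.Im q = 0 ->
  0 < complex.Im z -> 0 < complex.Im w -> forall k, 0 < k ->
  perm_eq (sqsides 0 1 w) [seq k * x | x <- sqsides p q z] ->
  complex.Im w = k * normc (p - q) * complex.Im z.
Proof.
move=> p0 q0 z0 w0 k k0 e.
have := pedoe_perm e; rewrite pedoe_scale !pedoe_sides // !coshdii !mulr1.
rewrite /sqdist sub0r normcN normc1 expr1n => h.
have ge0 : 0 <= k * normc (p - q) * complex.Im z.
  by rewrite !mulr_ge0 ?normc_ge0 // ltW.
by apply/eqP; rewrite -(eqrXn2 (isT : (0 < 2)%N) (ltW w0) ge0); apply/eqP; lra.
Qed.

(** Normalization does not increase hyperbolic distances. Both normal forms list
    their sides in increasing order, and by the rearrangement inequality matching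
    the sides in this way minimizes the Pedoe form over all labellings. *)
Lemma fold_contraction p q z o w v : complex.Im p = 0 -> complex.Im q = 0 ->
  p != q -> 0 < complex.Im z -> 0 < complex.Im o -> Sigma w -> Sigma v ->
  proportional_sides p q z w -> proportional_sides p q o v ->
  coshd w v <= coshd z o.
Proof.
move=> p0 q0 pq z0 o0 Sw Sv [k k0 ek] [l l0 el].
have w0 : 0 < complex.Im w by case: Sw.
have v0 : 0 < complex.Im v by case: Sv.
have ew := proportional_Im p0 q0 z0 w0 k0 ek.
have ev := proportional_Im p0 q0 o0 v0 l0 el.
have npq : 0 < normc (p - q) by rewrite normc_gt0 subr_eq0.
have c0 : 0 < 4 * complex.Im w * complex.Im v by rewrite !mulr_gt0.
have [sw e] := Sigma_sides Sw; have [sv _] := Sigma_sides Sv.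
rewrite -(ler_pM2l c0).
have -> : 4 * complex.Im w * complex.Im v * coshd w v
   = pedoe (sqsides 0 1 w) (sqsides 0 1 v).
  by rewrite pedoe_sides // e mulr1.
have -> : 4 * complex.Im w * complex.Im v * coshd z o
   = pedoe [seq k * x | x <- sqsides p q z] [seq l * x | x <- sqsides p q o].
  by rewrite pedoe_scale pedoe_sides // ew ev /sqdist; ring.
(* Rescaling and relabelling preserve the total of the squared sides, so only the
   sums of products remain to be compared. *)
rewrite /pedoe !(perm_big _ ek) !(perm_big _ el) /= lerD2l lerN2 ler_pM2l //.
rewrite !big_cons !big_nil /= !addr0.
rewrite !addrA; exact: rearrangement sw sv ek el.
Qed.

(** * Existence of normalized forms *)

(** Twice the signed area of the triangle; it vanishes exactly when the three
    points are collinear. *)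
Definition orientation p q r : R := complex.Im ((r - p) * (q - p)^*%C).

Lemma normc_conj z : normc z^*%C = normc z.
Proof. by case: z => a b; rewrite /= sqrrN. Qed.

Lemma similarity_to_unit_base p q : p != q ->
  similarity (fun t => (t - p) / (q - p)) /\
  similarity (fun t => ((t - p) / (q - p))^*%C).
Proof.
rewrite eq_sym -subr_eq0 => pq.
have k0 : 0 < normc (q - p)^-1 by rewrite normc_gt0 invr_eq0.
by split; exists (normc (q - p)^-1) => // x y;
  rewrite -?rmorphB /= ?normc_conj -mulrBl opprB addrA subrK normcM mulrC.
Qed.

(** Send the longest side [p q] to the segment from 0 to 1; if the apex lands in the
    lower half-plane, reflect it. *)
Lemma sorted_normal_form p q r : orientation p q r != 0 ->
  sqdist r p <= sqdist r q <= sqdist p q ->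
  exists w, Sigma w /\ similar_triangles [set p; q; r] (triangle w).
Proof.
move=> D0 /andP[ab bc].
have pq : p != q by apply: contra_neq D0 => ->; rewrite /orientation subrr conjc0 mulr0.
have [s1 s2] := similarity_to_unit_base pq.
have qp0 : q - p != 0 by rewrite subr_eq0 eq_sym.
set u := (r - p) / (q - p).
have Nqp : 0 < sqdist p q by rewrite exprn_gt0 // normc_gt0 subr_eq0.
have eu : u * (q - p) = r - p by rewrite divfK.
have ImuE : complex.Im u * sqdist p q = orientation p q r.
  rewrite /orientation -eu sqdistE; case: (u) (q) (p) => [? ?] [? ?] [? ?] /=.
  by ring.
have Imu0 : complex.Im u != 0.
  by apply: contra_neq D0 => e; rewrite -ImuE e mul0r.
have uE : sqdist u 0 * sqdist p q = sqdist r p.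
  by rewrite (sqdistC p) /sqdist subr0 -exprMn -normcM eu.
have u1E : sqdist u 1 * sqdist p q = sqdist r q.
  rewrite (sqdistC p) /sqdist -exprMn -normcM mulrBl eu mul1r.
  by rewrite opprB addrA subrK.
have ab' : sqdist u 0 <= sqdist u 1 by rewrite -(ler_pM2r Nqp) uE u1E.
have bc' : sqdist u 1 <= 1 by rewrite -(ler_pM2r Nqp) u1E mul1r.
have img f : f p = 0 -> f q = 1 -> f @` [set p; q; r] = triangle (f r).
  by move=> fp fq; rewrite !image_setU !image_set1 fp fq.
have SigP w : 0 < complex.Im w ->
    sqdist w 0 = sqdist u 0 -> sqdist w 1 = sqdist u 1 -> Sigma w.
  move=> w0 e0 e1; apply/SigmaE; split; rewrite ?e1 //.
  by move: ab'; rewrite -e0 -e1 !sqdistE /=; lra.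
case/orP: (lt_total Imu0) => Imu.
- exists u^*%C; split; last first.
    exists (fun t => ((t - p) / (q - p))^*%C) => //.
    by rewrite img // ?subrr ?mul0r ?conjc0 // divff // conjc1.
  apply: SigP; first by case: (u) Imu => a b /=; rewrite oppr_gt0.
    by rewrite -[0 in LHS]conjc0 /sqdist -rmorphB /= normc_conj.
  by rewrite -[1 in LHS]conjc1 /sqdist -rmorphB /= normc_conj.
- exists u; split; first exact: SigP.
  exists (fun t => (t - p) / (q - p)) => //.
  by rewrite img // ?subrr ?mul0r // divff.
Qed.

Lemma orientation_rot p q r : orientation p q r = orientation q r p.
Proof. by case: p q r => [? ?] [? ?] [? ?]; rewrite /orientation /=; ring. Qed.

Lemma orientation_swap p q r : orientation p q r = - orientation q p r.
Proof. by case: p q r => [? ?] [? ?] [? ?]; rewrite /orientation /=; ring. Qed.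

Lemma normal_form_exists p q r : orientation p q r != 0 ->
  exists w, Sigma w /\ similar_triangles [set p; q; r] (triangle w).
Proof.
wlog pq : p q r / sqdist r p <= sqdist r q => [H|].
  case: (leP (sqdist r p) (sqdist r q)) => [|/ltW] h D; first exact: H.
  by rewrite (setUC [set p]); apply: H => //; rewrite orientation_swap oppr_eq0.
move=> D.
case: (leP (sqdist r q) (sqdist p q)) => h1.
  by apply: sorted_normal_form; rewrite ?pq.
case: (leP (sqdist r p) (sqdist p q)) => h2.
  rewrite -setUA setUC (setUC [set q]); apply: sorted_normal_form.
    by rewrite orientation_swap oppr_eq0 -orientation_rot.
  by rewrite (sqdistC p r) h2 ltW.
rewrite -setUA setUC; apply: sorted_normal_form; first by rewrite -orientation_rot.
by rewrite (sqdistC p r) (sqdistC q r) (ltW h2) pq.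
Qed.

Lemma Sigma_normalized_form p q r : orientation p q r != 0 ->
  Sigma (normalized_form [set p; q; r]) /\
  similar_triangles [set p; q; r] (triangle (normalized_form [set p; q; r])).
Proof.
move=> /normal_form_exists h; rewrite /normalized_form.
by case: xgetP => [w _ []|H] //; case: h => w [? ?]; case: (H w).
Qed.

(** * Orbits stay near the centres *)

Definition is_omega v := [\/ v = omega1, v = omega2 | v = omega3].

Lemma proportional_by k (x y t : R) p q r w : 0 < k ->
  k * sqdist r p = x -> k * sqdist q r = y -> k * sqdist p q = t ->
  perm_eq (sqsides 0 1 w) [:: x; y; t] -> proportional_sides p q r w.
Proof. by move=> k0 <- <- <- e; exists k. Qed.

Definition thirdE := (Re_third 1, Im_third 1, Re_third 2, Im_third 2).

(** The right-angled triangle [omega1] is its own left and middle child; the right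
    children lead from [omega1] to [omega2] and from there to [omega3], which is its
    own right child. Thus the three centres are closed under trisection. *)
Lemma omega_trisection v : is_omega v ->
  [/\ exists2 v', is_omega v' & proportional_sides 0 (1 / 3) v v',
      exists2 v', is_omega v' & proportional_sides (1 / 3) (2 / 3) v v' &
      exists2 v', is_omega v' & proportional_sides (2 / 3) 1 v v'].
Proof.
have s1 : sqsides 0 1 (omega1 : R[i]) = [:: 1 / 3; 2 / 3; 1].
  by rewrite /sqsides !sqdistE /=; congr [:: _; _; _]; have := sqrt2_sq; lra.
have s2 : sqsides 0 1 (omega2 : R[i]) = [:: 1 / 6; 1 / 2; 1].
  by rewrite /sqsides !sqdistE /=; congr [:: _; _; _]; have := sqrt2_sq; lra.
have s3 : sqsides 0 1 (omega3 : R[i]) = [:: 2 / 9; 1 / 3; 1].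
  by rewrite /sqsides !sqdistE /=; congr [:: _; _; _]; have := sqrt2_sq; lra.
have [i1 i2 i3] : [/\ is_omega omega1, is_omega omega2 & is_omega omega3].
  by split; [exact: Or31 | exact: Or32 | exact: Or33].
case=> ->; split.
- exists omega1 => //; apply: (@proportional_by 3 1 (2 / 3) (1 / 3)) => //;
    last (by rewrite s1; apply/permP => P /=; do 3 case: (P _));
    by rewrite sqdistE ?thirdE /=; have := sqrt2_sq; lra.
- exists omega1 => //; apply: (@proportional_by 3 (2 / 3) 1 (1 / 3)) => //;
    last (by rewrite s1; apply/permP => P /=; do 3 case: (P _));
    by rewrite sqdistE ?thirdE /=; have := sqrt2_sq; lra.
- exists omega2 => //; apply: (@proportional_by (3 / 2) (1 / 2) 1 (1 / 6)) => //;
    last (by rewrite s2; apply/permP => P /=; do 3 case: (P _));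
    by rewrite sqdistE ?thirdE /=; have := sqrt2_sq; lra.
- exists omega1 => //; apply: (@proportional_by 6 1 (1 / 3) (2 / 3)) => //;
    last (by rewrite s1; apply/permP => P /=; do 3 case: (P _));
    by rewrite sqdistE ?thirdE /=; have := sqrt2_sq; lra.
- exists omega1 => //; apply: (@proportional_by 6 (1 / 3) 1 (2 / 3)) => //;
    last (by rewrite s1; apply/permP => P /=; do 3 case: (P _));
    by rewrite sqdistE ?thirdE /=; have := sqrt2_sq; lra.
- exists omega3 => //; apply: (@proportional_by 2 (1 / 3) 1 (2 / 9)) => //;
    last (by rewrite s3; apply/permP => P /=; do 3 case: (P _));
    by rewrite sqdistE ?thirdE /=; have := sqrt2_sq; lra.
- exists omega2 => //; apply: (@proportional_by (9 / 2) 1 (1 / 6) (1 / 2)) => //;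
    last (by rewrite s2; apply/permP => P /=; do 3 case: (P _));
    by rewrite sqdistE ?thirdE /=; have := sqrt2_sq; lra.
- exists omega1 => //; apply: (@proportional_by 9 (1 / 3) (2 / 3) 1) => //;
    last (by rewrite s1; apply/permP => P /=; do 3 case: (P _));
    by rewrite sqdistE ?thirdE /=; have := sqrt2_sq; lra.
- exists omega3 => //; apply: (@proportional_by 3 (2 / 9) 1 (1 / 3)) => //;
    last (by rewrite s3; apply/permP => P /=; do 3 case: (P _));
    by rewrite sqdistE ?thirdE /=; have := sqrt2_sq; lra.
Qed.

Lemma omega_Sigma v : is_omega v -> Sigma v.
Proof.
have s2 := sqrt2_sq; have s0 := sqrt2_gt0.
by case=> ->; apply/SigmaE; split; rewrite ?sqdistE /=; lra.
Qed.

Definition near_omega c w := exists2 v, is_omega v & coshd w v <= c.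

Lemma near_omega_step c p q z : complex.Im p = 0 -> complex.Im q = 0 -> p != q ->
  (forall v, is_omega v -> exists2 v', is_omega v' & proportional_sides p q v v') ->
  Sigma z -> near_omega c z ->
  Sigma (normalized_form [set p; q; z]) /\ near_omega c (normalized_form [set p; q; z]).
Proof.
move=> p0 q0 pq tri [z0 _ _] [v vo zv].
have [|Sw sim] := @Sigma_normalized_form p q z.
  have -> : orientation p q z = (complex.Re q - complex.Re p) * complex.Im z.
    move: p0 q0; rewrite /orientation.
    by case: (p) (q) (z) => [? ?] [? ?] [? ?] /= -> ->; ring.
  rewrite mulf_neq0 ?(gt_eqF z0) // subr_eq0; apply: contra pq => /eqP.
  by move: p0 q0; case: (p) (q) => [? ?] [? ?] /= -> -> ->.
split => //; set w := normalized_form _ in Sw sim *.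
have v0 : 0 < complex.Im v by have /SigmaE[] := omega_Sigma vo.
have w0 : 0 < complex.Im w by case: Sw.
have [v' vo' sim'] := tri v vo.
exists v' => //; apply: le_trans zv; have Sv' := omega_Sigma vo'.
exact: (fold_contraction p0 q0 pq z0 v0 Sw Sv' (similar_proportional w0 sim) sim').
Qed.

(** The points of [Sigma] within a given distance of the set of centres are closed
    under trisection, because each step is a contraction and carries the centres
    into each other. *)
Lemma orbit_near_omega c z z' : Sigma z -> near_omega c z -> LE3_orbit z z' ->
  Sigma z' /\ near_omega c z'.
Proof.
move=> Sz nz /(_ [set w | Sigma w /\ near_omega c w]); apply; split.
  split; first by move=> w [].
  move=> w [Sw nw].
  have Re_neq (p q : R[i]) : complex.Re p < complex.Re q -> p != q.
    by apply: contraTneq => ->; rewrite ltxx.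
  have n0 : (0 : R[i]) != 1 / 3 by apply: Re_neq; rewrite thirdE /=; lra.
  have n1 : (1 / 3 : R[i]) != 2 / 3 by apply: Re_neq; rewrite !thirdE; lra.
  have n2 : (2 / 3 : R[i]) != 1 by apply: Re_neq; rewrite thirdE /=; lra.
  split; apply: near_omega_step; rewrite ?thirdE //.
  - by move=> v /omega_trisection[].
  - by move=> v /omega_trisection[].
  - by move=> v /omega_trisection[].
by move=> w ->.
Qed.

(** * The region below the circles *)

(** The constant is twice cosh (ln (sqrt 2)) = 3 sqrt 2 / 4: it makes the hypothesis
    the Euclidean equation of the hyperbolic disc. *)
Lemma hdisc_euclid (x y a h : R) :
  0 < y -> 0 < h -> (x - a) ^+ 2 + y ^+ 2 + h ^+ 2 <= 3 / 2 * Num.sqrt 2 * y * h ->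
  hdisc (a +i* h)%C (x +i* y)%C.
Proof.
move=> y0 h0 H; split => //.
set z := (x +i* y)%C; set o := (a +i* h)%C.
have s2 := sqrt2_sq; have s0 := sqrt2_gt0.
have yh : 0 < 2 * y * h by rewrite !mulr_gt0.
rewrite /hdist -/(sqdist z o) -/(coshd z o).
have c1 : 1 <= coshd z o by rewrite lerDl divr_ge0 ?sqdist_ge0 // ltW.
have c2 : coshd z o <= 3 / 4 * Num.sqrt 2.
  rewrite -(ler_pM2l yh) mulrDr mulr1 mulrCA mulfV ?gt_eqF // mulr1 sqdistE /=.
  lra.
have sq0 : 0 <= Num.sqrt (coshd z o ^+ 2 - 1) by rewrite sqrtr_ge0.
have sq1 : Num.sqrt (coshd z o ^+ 2 - 1) <= Num.sqrt 2 / 4.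
  rewrite -[leRHS]ger0_norm ?divr_ge0 ?(ltW s0) // -sqrtr_sqr ler_wsqrtr //.
  have : coshd z o ^+ 2 <= (3 / 4 * Num.sqrt 2) ^+ 2.
    by rewrite ler_sqr ?nnegrE ?(le_trans ler01 c1) //; lra.
  by rewrite !exprMn s2; lra.
rewrite /arcosh ler_ln ?posrE //; lra.
Qed.

Lemma normc_ge_Re z : `|complex.Re z| <= normc z.
Proof. by case: z => a b /=; rewrite -sqrtr_sqr ler_wsqrtr // lerDl sqr_ge0. Qed.

Lemma normc_ge_Im z : `|complex.Im z| <= normc z.
Proof. by case: z => a b /=; rewrite -sqrtr_sqr ler_wsqrtr // lerDr sqr_ge0. Qed.

(** The norm of the field [R[i]] takes its values in [R[i]], so that continuity of a
    real function on [(R[i])^o] has to be read off from balls of complex radius. *)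
Lemma lipschitz_continuous k (f : (R[i])^o -> R) : 0 < k ->
  (forall z w, `|f z - f w| <= k * normc (z - w)) -> continuous f.
Proof.
move=> k0 lip z.
apply/(@cvgrPdist_le _ _ _ (nbhs z) (@nbhs_filter (R[i])^o z)) => e e0.
have e0' : 0 < (e / k)%:C%C by rewrite ltcR divr_gt0.
apply/(@nbhs_ballP _ (R[i])^o); exists (e / k)%:C%C => // w.
rewrite -ball_normE /ball_ /= => zw.
apply: le_trans (lip z w) _; rewrite -ler_pdivlMl // mulrC.
by rewrite -lecR ltW.
Qed.

Definition half_plane (a b c : R) : set (R[i])^o :=
  [set z | 0 < a * complex.Re z + b * complex.Im z + c].

Lemma open_half_plane (a b c : R) : open (half_plane a b c).
Proof.
pose f (z : (R[i])^o) : R := a * complex.Re z + b * complex.Im z + c.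
have cf : continuous f.
  apply: (@lipschitz_continuous (`|a| + `|b| + 1)) => [|z w].
    by rewrite ltr_wpDl // addr_ge0.
  have -> : f z - f w = a * complex.Re (z - w) + b * complex.Im (z - w).
    by rewrite !raddfB /f /=; ring.
  apply: le_trans (ler_normD _ _) _; rewrite !normrM !mulrDl mul1r -[leLHS]addr0.
  by rewrite !lerD ?normc_ge0 // ler_wpM2l // ?normc_ge_Re ?normc_ge_Im.
have -> : half_plane a b c = f @^-1` [set x | 0 < x] by [].
by apply: open_comp; [move=> z _; exact: cf | exact: open_gt].
Qed.

(** The two sides of the broken line through the point 1/5 + 3i/5, where the first
    circle touches the arc |z - 1| = 1, the centre of the first circle, the centre of
    the second, the centre of the third, and the point 1/2 + i/6 where the third
    touches the line Re z = 1/2. All centres are the Euclidean ones. Inside [Sigma]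
    this line stays in the discs. *)
Definition below : set (R[i])^o :=
  (half_plane (-1) 0 (1 / 3) `&` half_plane (- (3 / 4)) (-1) (3 / 4)) `|`
  half_plane 0 (-1) (1 / 6) `|` half_plane (- (3 / 4)) (-1) (1 / 2).

Definition above : set (R[i])^o :=
  (half_plane 1 0 (- (1 / 3)) `|` half_plane (3 / 4) 1 (- (3 / 4))) `&`
  half_plane 0 1 (- (1 / 6)) `&` half_plane (3 / 4) 1 (- (1 / 2)).

Lemma open_below : open below.
Proof. by apply: openU; [apply: openU; [apply: openI|]|]; exact: open_half_plane. Qed.

Lemma open_above : open above.
Proof. by apply: openI; [apply: openI; [apply: openU|]|]; exact: open_half_plane. Qed.

Lemma below_above z : below z -> above z -> False.
Proof.
by rewrite /below /above /half_plane => -[[[/= ? ?]|/= ?]|/= ?] [[[/= ?|/= ?] /= ?] /= ?]; lra.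
Qed.

(** A point of [Sigma] on neither side lies on the broken line, each segment of which is
    made of radii of the discs. *)
Lemma Sigma_minus_discs_sub z : Sigma_minus_discs z -> below z \/ above z.
Proof.
case: z => x y [/SigmaE[/= y0 x2]]; rewrite sqdistE /= subr0 => n1 nD.
have s2 := sqrt2_sq; have s0 := sqrt2_gt0.
have sy : Num.sqrt 2 ^+ 2 * y = 2 * y by rewrite s2.
have d1 : ~ ((x - 1 / 3) ^+ 2 + (y - 1 / 2) ^+ 2 <= (1 / 6) ^+ 2).
  move=> h; apply: nD; left; left; apply: hdisc_euclid; first by []; first by lra.
  by lra.
have d2 : ~ ((x - 1 / 3) ^+ 2 + (y - 1 / 4) ^+ 2 <= (1 / 12) ^+ 2).
  move=> h; apply: nD; left; right; apply: hdisc_euclid; first by []; first by lra.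
  by lra.
have d3 : ~ ((x - 4 / 9) ^+ 2 + (y - 1 / 6) ^+ 2 <= (1 / 18) ^+ 2).
  move=> h; apply: nD; right; apply: hdisc_euclid; first by []; first by lra.
  by lra.
have [h|h] := pselect (below (x +i* y)%C); [by left | right].
have b1 : 1 / 3 <= x \/ 3 / 4 - 3 / 4 * x <= y.
  case: (leP (1 / 3) x) => hx; first by left.
  by right; rewrite leNgt; apply/negP => hy; apply: h; left; left; split; rewrite /half_plane /=; lra.
have b2 : 1 / 6 <= y.
  by rewrite leNgt; apply/negP => hy; apply: h; left; right; rewrite /half_plane /=; lra.
have b3 : 1 / 2 - 3 / 4 * x <= y.
  by rewrite leNgt; apply/negP => hy; apply: h; right; rewrite /half_plane /=; lra.
rewrite /above /half_plane /=; split; [split|].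
- case: (ltP (1 / 3) x) => hx; [by left; lra | right].
  suff : 3 / 4 - 3 / 4 * x < y by lra.
  rewrite ltNge; apply/negP => hy.
  case: b1 => hb.
    (* The vertical segment between the centres of the first two circles, which
       touch at 1/3 + i/3. *)
    have {hb hx} ex : x = 1 / 3 by lra.
    case: (leP y (1 / 3)) => h3.
      apply: d2; have : (y - 1 / 4) ^+ 2 <= (1 / 12) ^+ 2 by apply: sqr_le_sqr; lra.
      by rewrite ex subrr expr0n add0r.
    apply: d1; have : (y - 1 / 2) ^+ 2 <= (1 / 6) ^+ 2 by apply: sqr_le_sqr; lra.
    by rewrite ex subrr expr0n add0r.
  (* The segment from the point of contact with the arc to the first centre. *)
  have ey : y = 3 / 4 * (1 - x) by lra.
  have x5 : 1 / 5 <= x.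
    rewrite leNgt; apply/negP => hx5.
    have : (4 / 5) ^+ 2 < (1 - x) ^+ 2 by rewrite ltr_sqr ?nnegrE; lra.
    by move: n1; rewrite ey; lra.
  apply: d1; have : (x - 1 / 3) ^+ 2 <= (2 / 15) ^+ 2 by apply: sqr_le_sqr; lra.
  by rewrite ey; lra.
- suff : 1 / 6 < y by lra.
  rewrite ltNge; apply/negP => hy; apply: d3.
  have {hy} ey : y = 1 / 6 by lra.
  have : (x - 4 / 9) ^+ 2 <= (1 / 18) ^+ 2 by apply: sqr_le_sqr; lra.
  by rewrite ey subrr expr0n addr0.
- suff : 1 / 2 - 3 / 4 * x < y by lra.
  rewrite ltNge; apply/negP => hy.
  have {hy b3} ey : y = 1 / 2 - 3 / 4 * x by lra.
  (* The segment between the last two centres; the circles touch at Re z = 2/5. *)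
  have x3 : 1 / 3 <= x by case: b1; lra.
  case: (leP x (2 / 5)) => hx.
    apply: d2; have : (x - 1 / 3) ^+ 2 <= (1 / 15) ^+ 2 by apply: sqr_le_sqr; lra.
    by rewrite ey; lra.
  apply: d3; have : (x - 4 / 9) ^+ 2 <= (2 / 45) ^+ 2 by apply: sqr_le_sqr; lra.
  by rewrite ey; lra.
Qed.

(** The component of a point above the line stays above it, where the imaginary part
    exceeds 1/6, so its closure misses the real axis. *)
Lemma Omega2_below z : Omega2 z -> below z.
Proof.
move=> [Sz [p [clp p0]]]; have [//|az] := Sigma_minus_discs_sub Sz; exfalso.
set C := connected_component (Sigma_minus_discs : set (R[i])^o) z in clp.
have Cz : C z by exact: connected_component_refl.
have Csub : C `<=` Sigma_minus_discs by exact: connected_component_sub.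
have CA : C `&` above = C.
  apply: (@component_connected _ (Sigma_minus_discs : set (R[i])^o) z).
  - by exists z.
  - by exists above => //; exact: open_above.
  - exists (~` below); first by apply: open_closedC; exact: open_below.
    apply/seteqP; split => w [Cw]; split => //.
      by move=> bw; exact: (below_above bw).
    by case: (Sigma_minus_discs_sub (Csub _ Cw)).
have [|w [Cw]] := clp (half_plane 0 (-1) (1 / 6)).
- apply: open_nbhs_nbhs; split; first exact: open_half_plane.
  by move: p0; rewrite /real_axis /half_plane /= => ->; lra.
rewrite /half_plane /= => hw; move: Cw; rewrite -CA => -[_ [[_]]].
by rewrite /half_plane /= => h _; clear -hw h; lra.
Qed.

(** * Distance to the centres and the apex cotangent *)

(** The cotangent of the angle at the apex of [triangle z], and also the hyperbolic
    sine of the signed distance from [z] to the geodesic from 0 to 1. *)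
Definition cotz z : R := (sqdist z 0 - complex.Re z) / complex.Im z.

(** On the hyperboloid, [w] and [o] are timelike unit vectors, the geodesic from 0 to 1
    is a spacelike one, and [coshd] and [cotz] are their products up to sign. The
    inequality is the sign of a Gram determinant: the difference is the square of the
    determinant of the three vectors. *)
Lemma cotz_coshd w o : 0 < complex.Im w -> 0 < complex.Im o ->
  (cotz w - coshd w o * cotz o) ^+ 2 <= (coshd w o ^+ 2 - 1) * (cotz o ^+ 2 + 1).
Proof.
move=> w0 o0; rewrite -subr_ge0.
suff -> : (coshd w o ^+ 2 - 1) * (cotz o ^+ 2 + 1) - (cotz w - coshd w o * cotz o) ^+ 2 =
  ((sqdist w 0 * (2 * complex.Re o - 1) - sqdist o 0 * (2 * complex.Re w - 1))
   / (2 * complex.Im w * complex.Im o)) ^+ 2 by exact: sqr_ge0.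
rewrite /coshd /cotz !sqdistE /=; field.
by rewrite !gt_eqF.
Qed.

Lemma omega_cotz v : is_omega v -> - Num.sqrt 2 <= cotz v <= 0.
Proof.
have s2 := sqrt2_sq; have s0 := sqrt2_gt0.
case=> ->; rewrite /cotz !sqdistE /=.
all: rewrite ler_pdivlMr ?ler_pdivrMr ?divr_gt0 //; apply/andP; split; lra.
Qed.

(** If cosh d = c then sinh (d + arsinh (sqrt 2)) is
    sqrt 2 * c + sqrt 3 * sqrt (c^2 - 1); the hypotheses say that [B] is at least this
    number. *)
Lemma cotz_lower_bound (c B : R) w : 0 < complex.Im w -> near_omega c w ->
  Num.sqrt 2 * c <= B -> 3 * (c ^+ 2 - 1) <= (B - Num.sqrt 2 * c) ^+ 2 ->
  - B <= cotz w.
Proof.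
move=> w0 [v vo qc] h1 h2.
have s2 := sqrt2_sq; have s0 := sqrt2_gt0.
have v0 : 0 < complex.Im v by case: (omega_Sigma vo).
have G := cotz_coshd w0 v0; have /andP[k1 k2] := omega_cotz vo.
have q1 : 1 <= coshd w v.
  by rewrite lerDl divr_ge0 ?sqdist_ge0 // !mulr_ge0 // ltW.
move: (cotz w) (cotz v) (coshd w v) G k1 k2 q1 qc => k l q G k1 k2 q1 qc.
rewrite leNgt; apply/negP => kB.
have t0 : - Num.sqrt 2 * c <= q * l.
  by apply: le_trans (_ : - Num.sqrt 2 * q <= _); nra.
have t1 : (B - Num.sqrt 2 * c) ^+ 2 < (q * l - k) ^+ 2.
  by rewrite ltr_sqr ?nnegrE; lra.
have t2 : q ^+ 2 <= c ^+ 2 by rewrite ler_sqr ?nnegrE; lra.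
have t3 : l ^+ 2 <= 2.
  have : l ^+ 2 <= Num.sqrt 2 ^+ 2 by apply: sqr_le_sqr; lra.
  by rewrite s2.
have t4 : (q ^+ 2 - 1) * (l ^+ 2 + 1) <= (c ^+ 2 - 1) * 3.
  have l0 := sqr_ge0 l; have : 1 ^+ 2 <= q ^+ 2 by rewrite ler_sqr ?nnegrE; lra.
  by move=> h; apply: ler_pM; lra.
by lra.
Qed.

(** For a fixed apex angle the distance to [omega1] is largest on the arc |z - 1| = 1,
    where the bound is an equality; k = 1/3 belongs to the point where the first circle
    touches the arc. Put m = k y and s = 1 - x: the inequality is
    (1 - s - m) (s - 3 m) >= 0, where 1 - s - m = 1 - |z - 1|^2. *)
Lemma below_cotz z : Sigma z -> below z -> 0 < cotz z ->
  cotz z <= 1 / 3 /\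
  coshd z omega1 <= (1 + 9 * cotz z ^+ 2) / (4 * Num.sqrt 2 * cotz z).
Proof.
have s2 := sqrt2_sq; have s0 := sqrt2_gt0.
case: z => x y /SigmaE[/= y0 x2]; rewrite sqdistE /= subr0 => n1 bz.
set k := cotz _; move=> k0.
have mE : x ^+ 2 + y ^+ 2 - x = k * y.
  by rewrite /k /cotz sqdistE /= divfK ?gt_eqF // !subr0.
clearbody k.
rewrite /below /half_plane in bz.
have m0 : 0 < k * y by rewrite mulr_gt0.
have xs : x < 1 / 3 /\ y < 3 / 4 * (1 - x).
  suff h : x < 1 / 3 by split=> //; case: bz => [[[/= ? ?]|/= ?]|/= ?]; lra.
  rewrite ltNge; apply/negP => hx.
  have hy : y <= 1 / 4 by case: bz => [[[/= ? ?]|/= ?]|/= ?]; lra.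
  have hy2 : y ^+ 2 <= (1 / 4) ^+ 2 by apply: sqr_le_sqr; lra.
  have : 0 <= (x - 1 / 3) * (1 - x - 1 / 3) by rewrite mulr_ge0; lra.
  by lra.
have [x3 yx] := xs.
have y2 : y ^+ 2 <= (3 / 4 * (1 - x)) ^+ 2 by rewrite ler_sqr ?nnegrE; lra.
(* In polar coordinates at 1 the radius is at most 1 and the angle has cosine at
   least 4/5. *)
have rs : (1 - x) ^+ 2 + y ^+ 2 <= 5 / 4 * (1 - x).
  case: (leP (1 - x) (4 / 5)) => hs; last by lra.
  have : 0 <= (1 - x) * (4 / 5 - (1 - x)) by rewrite mulr_ge0; lra.
  by lra.
have ms : k * y <= 1 / 4 * (1 - x) by lra.
have key : 0 <= (x - k * y) * (1 - x - 3 * (k * y)) by rewrite mulr_ge0; lra.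
split.
  have m9 : 9 * (k * y) <= 2 - x.
    by case: (leP (1 - x) (4 / 5)) => hs; lra.
  have : k * y * (9 * (k * y)) <= k * y * (2 - x) by rewrite ler_pM2l.
  have : 0 <= (1 - x) * (x - k * y) by rewrite mulr_ge0; lra.
  move=> h1 h2; have : (3 * (k * y)) ^+ 2 <= y ^+ 2 by lra.
  rewrite ler_sqr ?nnegrE; [|lra|lra] => h.
  by rewrite -(ler_pM2r y0); lra.
rewrite ler_pdivlMr ?mulr_gt0 // /coshd sqdistE /=.
rewrite -(ler_pM2r y0).
have -> : (1 + ((x - 1 / 3) ^+ 2 + (y - Num.sqrt 2 / 3) ^+ 2) / (2 * y * (Num.sqrt 2 / 3))) *
   (4 * Num.sqrt 2 * k) * y = 2 * (3 * ((x - 1 / 3) ^+ 2 + y ^+ 2) + (Num.sqrt 2) ^+ 2 / 3) * k.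
  by field; rewrite !gt_eqF.
have mE2 : k * y * (x ^+ 2 + y ^+ 2 - x) = (k * y) ^+ 2 by rewrite mE.
by rewrite s2 -(ler_pM2r y0); lra.
Qed.

(** Links the distance bound of [below_cotz] to the hypotheses of [cotz_lower_bound]. The
    value of [B] is a convenient weakening of the optimal one, tight to within half a
    percent at k = 1/3. *)
Lemma folded_bounds k : 0 < k -> k <= 1 / 3 ->
  let c := (1 + 9 * k ^+ 2) / (4 * Num.sqrt 2 * k) in
  let B := (Num.sqrt 2 * k)^-1 in
  Num.sqrt 2 * c <= B /\ 3 * (c ^+ 2 - 1) <= (B - Num.sqrt 2 * c) ^+ 2.
Proof.
move=> k0 k3 c B.
have s2 := sqrt2_sq; have s0 := sqrt2_gt0.
have sl : 141 / 100 <= Num.sqrt 2 :> R.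
  by rewrite -ler_sqr ?nnegrE ?s2; lra.
have k2 : 9 * k ^+ 2 <= 1.
  have : k ^+ 2 <= (1 / 3) ^+ 2 by rewrite ler_sqr ?nnegrE; lra.
  by lra.
have k20 := sqr_ge0 k.
have E : B - Num.sqrt 2 * c = (2 * Num.sqrt 2 - 1 - 9 * k ^+ 2) / (4 * k).
  rewrite /B /c; apply/eqP; rewrite -subr_eq0; apply/eqP.
  transitivity ((2 - Num.sqrt 2 ^+ 2) / (Num.sqrt 2 * (2 * k))).
    by field; rewrite !gt_eqF.
  by rewrite s2 subrr mul0r.
have Ec : c ^+ 2 = (1 + 9 * k ^+ 2) ^+ 2 / (32 * k ^+ 2).
  rewrite /c !exprMn exprVn !exprMn s2; field.
  by rewrite gt_eqF.
split.
  by rewrite -subr_ge0 E divr_ge0; lra.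
rewrite E Ec exprMn exprVn -subr_ge0.
have -> : ((2 * Num.sqrt 2 - 1 - 9 * k ^+ 2) ^+ 2 * (4 * k) ^- 2 -
  3 * ((1 + 9 * k ^+ 2) ^+ 2 / (32 * k ^+ 2) - 1)) =
  (2 * (2 * Num.sqrt 2 - 1 - 9 * k ^+ 2) ^+ 2 -
   3 * ((1 + 9 * k ^+ 2) ^+ 2 - 32 * k ^+ 2)) / (32 * k ^+ 2).
  by field; rewrite gt_eqF.
apply: divr_ge0; last by rewrite mulr_ge0.
have : 0 <= (1 - 9 * k ^+ 2) * k ^+ 2 by rewrite mulr_ge0; lra.
have : 0 <= (1 - 9 * k ^+ 2) * (Num.sqrt 2 - 141 / 100) by rewrite mulr_ge0; lra.
nra.
Qed.

(** * Angles *)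

Lemma angleE p q r : orientation p q r != 0 ->
  angle p q r = pi / 2 - atan (complex.Re ((q - p) * ((r - p)^*)%C) / `|orientation p q r|).
Proof.
rewrite /orientation /angle; move: (q - p) (r - p) => [a b] [c d] /= D0.
set n := a * c - b * - d; set D := `| _ |.
have D2 : 0 < D by rewrite normr_gt0.
have -> : Num.sqrt (a ^+ 2 + b ^+ 2) * Num.sqrt (c ^+ 2 + d ^+ 2) = Num.sqrt (n ^+ 2 + D ^+ 2).
  rewrite -sqrtrM ?addr_ge0 ?sqr_ge0 //; congr Num.sqrt.
  by rewrite /D /n real_normK ?num_real //; ring.
have -> : n / Num.sqrt (n ^+ 2 + D ^+ 2) = cos (pi / 2 - atan (n / D)).
  rewrite -cosN opprB cosBpihalf -[sin _]mulr1 -(@divff _ (cos (atan (n / D)))).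
    rewrite mulrCA mulrC -/(tan _) atanK cos_atan.
    have -> : n ^+ 2 + D ^+ 2 = (1 + (n / D) ^+ 2) * D ^+ 2.
      by field; rewrite gt_eqF.
    rewrite sqrtrM ?addr_ge0 ?sqr_ge0 // sqrtr_sqr gtr0_norm //.
    by rewrite invfM mulrA mulrAC.
  by rewrite gt_eqF // cos_gt0_pihalf // atan_gtNpi2 atan_ltpi2.
rewrite cosK // in_itv /=; have := atan_gtNpi2 (n / D); have := atan_ltpi2 (n / D).
by move=> h1 h2; apply/andP; split; lra.
Qed.

Lemma angle_apex z : 0 < complex.Im z -> angle z 0 1 = pi / 2 - atan (cotz z).
Proof.
case: z => x y /= y0; have D : orientation (x +i* y)%C 0 1 = y by rewrite /orientation /=; ring.
rewrite angleE D ?gt_eqF // gtr0_norm // /cotz sqdistE /=; congr (_ - atan (_ / _)).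
by ring.
Qed.

(** The apex of a normalized triangle lies above its base. *)
Lemma base_angles z : Sigma z -> angle 0 1 z <= pi / 2 /\ angle 1 0 z <= pi / 2.
Proof.
case: z => x y /SigmaE[/= y0 x2]; rewrite sqdistE /= subr0 => n1.
have D : orientation 0 1 (x +i* y)%C = y by rewrite /orientation /=; ring.
have D' : orientation 1 0 (x +i* y)%C = - y by rewrite /orientation /=; ring.
have a0 t : 0 <= t -> 0 <= atan t :> R by move=> t0; rewrite -atan0 le_atan.
have y2 := sqr_ge0 y; have xx := sqr_ge0 x.
by split; rewrite angleE ?D ?D' ?oppr_eq0 ?gt_eqF // gerBl a0 // divr_ge0 //=;
   [lra|lra].
Qed.

Lemma le_largest_angle z : Sigma z -> forall t : R, pi / 2 <= t ->
  pi / 2 - atan (cotz z) <= t -> largest_angle z <= t.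
Proof.
move=> Sz t t0 h; have [b1 b2] := base_angles Sz; have z0 : 0 < complex.Im z by case: Sz.
by rewrite /largest_angle !ge_max angle_apex // h (le_trans b1) // (le_trans b2).
Qed.

Lemma ge_largest_angle z : 0 < complex.Im z -> pi / 2 - atan (cotz z) <= largest_angle z.
Proof. by move=> z0; rewrite /largest_angle -angle_apex // !le_max lexx !orbT. Qed.

(** * Arctangent estimates *)

Lemma ndecr_derive_ge0 (f df : R -> R) : (forall x : R, is_derive x 1 f (df x)) ->
  (forall x, 0 <= x -> 0 <= df x) -> forall x y, 0 <= x -> x <= y -> f x <= f y.
Proof.
move=> fd df0 x y x0 xy.
have dv t : derivable f t 1 by have := fd t; case.
apply: (@ger0_derive1_ndecry _ f 0) => //.
- move=> t; rewrite in_itv /= andbT => t0.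
  by rewrite derive1E (@derive_val _ _ _ _ _ _ _ (fd t)) df0 // ltW.
- apply: continuous_subspaceT => t; apply: differentiable_continuous.
  by apply/derivable1_diffP.
Qed.

Lemma atan_lower (x : R) : 0 <= x -> x - x ^+ 3 / 3 + x ^+ 5 / 5 - x ^+ 7 / 7 <= atan x.
Proof.
move=> x0; rewrite -subr_ge0.
pose f t : R := atan t - (t - t ^+ 3 / 3 + t ^+ 5 / 5 - t ^+ 7 / 7).
pose df t : R := (1 + t ^+ 2)^-1 - (1 - t ^+ 2 + t ^+ 4 - t ^+ 6).
have fd (t : R) : is_derive t 1 f (df t).
  rewrite /f /df; apply: is_derive_eq; rewrite /GRing.scale /=.
  by field; rewrite gt_eqF // ltr_pwDl ?sqr_ge0.
have -> : 0 = f 0 by rewrite /f atan0; ring.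
apply: (@ndecr_derive_ge0 f df) => // t t0.
rewrite /df; have p : 0 < 1 + t ^+ 2 by rewrite ltr_pwDl ?sqr_ge0.
have -> : (1 + t ^+ 2)^-1 - (1 - t ^+ 2 + t ^+ 4 - t ^+ 6) = t ^+ 8 / (1 + t ^+ 2).
  by field; rewrite gt_eqF.
by rewrite divr_ge0 ?exprn_ge0 // ltW.
Qed.

Lemma atan_upper (x : R) : 0 <= x -> atan x <= x - x ^+ 3 / 3 + x ^+ 5 / 5.
Proof.
move=> x0; rewrite -subr_ge0.
pose f t : R := (t - t ^+ 3 / 3 + t ^+ 5 / 5) - atan t.
pose df t : R := (1 - t ^+ 2 + t ^+ 4) - (1 + t ^+ 2)^-1.
have fd (t : R) : is_derive t 1 f (df t).
  rewrite /f /df; apply: is_derive_eq; rewrite /GRing.scale /=.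
  by field; rewrite gt_eqF // ltr_pwDl ?sqr_ge0.
have -> : 0 = f 0 by rewrite /f atan0; ring.
apply: (@ndecr_derive_ge0 f df) => // t t0.
rewrite /df; have p : 0 < 1 + t ^+ 2 by rewrite ltr_pwDl ?sqr_ge0.
have -> : (1 - t ^+ 2 + t ^+ 4) - (1 + t ^+ 2)^-1 = t ^+ 6 / (1 + t ^+ 2).
  by field; rewrite gt_eqF.
by rewrite divr_ge0 ?exprn_ge0 // ltW.
Qed.

Lemma atanV (x : R) : 0 < x -> atan x^-1 = pi / 2 - atan x.
Proof.
move=> x0; have t0 : 0 < atan x by rewrite -atan0 lt_atan.
have t1 := atan_ltpi2 x.
have c0 : cos (atan x) != 0 by rewrite gt_eqF // cos_gt0_pihalf // t1 andbT; lra.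
have -> : x^-1 = tan (pi / 2 - atan x).
  rewrite -[x in LHS]atanK /tan invf_div; congr (_ / _).
    by rewrite -cosN -cosBpihalf; congr cos; ring.
  by rewrite -cosN opprB cosBpihalf.
by rewrite tanK // in_itv /=; apply/andP; split; lra.
Qed.

Lemma piquarter_atan : pi / 4 = atan (1 / 2) + atan (1 / 3) :> R.
Proof.
have p0 := pi_gt0 R.
have a1 : 0 < atan (1 / 2) :> R by rewrite -atan0 lt_atan //; lra.
have a2 : 0 < atan (1 / 3) :> R by rewrite -atan0 lt_atan //; lra.
have b1 : atan (1 / 2) <= pi / 4 :> R by rewrite -atan1 le_atan //; lra.
have b2 : atan (1 / 3) < pi / 4 :> R by rewrite -atan1 lt_atan //; lra.
rewrite -atan1 -[RHS]tanK; last by rewrite in_itv /=; apply/andP; split; lra.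
congr atan; rewrite tanD ?gt_eqF ?cos_gt0_pihalf ?atan_gtNpi2 ?atan_ltpi2 //.
by rewrite !atanK; field.
Qed.

(** The function 2.165 atan t - atan (sqrt 2 t) increases, so that it suffices to treat
    k = 1/3. There pi is eliminated by [piquarter_atan], and truncated arctangent series
    decide the inequality, with a margin of about 0.002. *)
Lemma angle_ratio k : 0 < k -> k <= 1 / 3 ->
  pi / 2 + atan (Num.sqrt 2 * k)^-1 <= 2165 / 1000 * (pi / 2 - atan k).
Proof.
move=> k0 k3.
have s2 := sqrt2_sq; have s0 := sqrt2_gt0.
have sl : 141 / 100 <= Num.sqrt 2 :> R by rewrite -ler_sqr ?nnegrE ?s2; lra.
have su : Num.sqrt 2 <= 2 :> R by rewrite -ler_sqr ?nnegrE ?s2; lra.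
rewrite atanV ?mulr_gt0 //.
pose f t : R := 2165 / 1000 * atan t - atan (Num.sqrt 2 * t).
pose df t : R := 2165 / 1000 * (1 + t ^+ 2)^-1 - Num.sqrt 2 * (1 + (Num.sqrt 2 * t) ^+ 2)^-1.
have fd (t : R) : is_derive t 1 f (df t).
  rewrite /f /df; apply: is_derive_eq; rewrite /GRing.scale /=.
  by rewrite mulr1 [_^-1 * _]mulrC.
have mono : f k <= f (1 / 3).
  apply: (@ndecr_derive_ge0 f df) => //; last exact: ltW.
  move=> t t0; rewrite /df subr_ge0.
  have h : (1 + (Num.sqrt 2 * t) ^+ 2)^-1 <= (1 + t ^+ 2)^-1.
    rewrite lef_pV2 ?posrE ?ltr_pwDl ?sqr_ge0 // exprMn s2.
    by have := sqr_ge0 t; lra.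
  by apply: ler_pM; [exact: ltW | rewrite invr_ge0 addr_ge0 ?sqr_ge0 | lra | exact: h].
have h1 : atan (1 / 3) <= 1 / 3 - (1 / 3) ^+ 3 / 3 + (1 / 3) ^+ 5 / 5 :> R.
  by apply: atan_upper; lra.
have h2 : 1 / 2 - (1 / 2) ^+ 3 / 3 + (1 / 2) ^+ 5 / 5 - (1 / 2) ^+ 7 / 7 <= atan (1 / 2) :> R.
  by apply: atan_lower; lra.
(* A rational lower bound of sqrt 2 / 3. *)
pose x0 : R := 47 / 100.
have h3 : x0 - x0 ^+ 3 / 3 + x0 ^+ 5 / 5 - x0 ^+ 7 / 7 <= atan (Num.sqrt 2 * (1 / 3)).
  apply: le_trans (_ : atan x0 <= _); first by apply: atan_lower; rewrite /x0; lra.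
  by rewrite le_atan // /x0; lra.
have m := piquarter_atan; move: mono; rewrite /f => mono.
by rewrite /x0 in h3; clear -m h1 h2 h3 mono; lra.
Qed.

End LongestEdgeTrisection.

Theorem theorem5 (R : realType) :
  exists c : R, c < 21652 / 10000 /\
    forall z z' : R[i], Omega2 z -> LE3_orbit z z' ->
      largest_angle z' <= c * largest_angle z.
Proof.
exists (2165 / 1000); split; first by lra.
move=> z z' Oz zz'.
have Sz : Sigma z by case: Oz => [[]].
have bz := Omega2_below Oz.
have z0 : 0 < complex.Im z by case: Sz.
have near_z : near_omega (coshd z omega1) z by exists omega1 => //; exact: Or31.
have [Sz' nz'] := orbit_near_omega Sz near_z zz'.
have z0' : 0 < complex.Im z' by case: Sz'.
have gz := ge_largest_angle z0.
have p0 := pi_gt0 R.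
have au := atan_ltpi2 (cotz z').
have al := atan_gtNpi2 (cotz z').
(* A non-acute apex angle, at least pi / 2, leaves nothing to show, as c >= 2. *)
case: (leP (cotz z) 0) => k0.
  have : atan (cotz z) <= 0 by rewrite -atan0 le_atan.
  by move=> h; apply: le_largest_angle => //; lra.
have [k3 qz] := below_cotz Sz bz k0.
have [h1 h2] := folded_bounds k0 k3.
have nz'' : near_omega ((1 + 9 * cotz z ^+ 2) / (4 * Num.sqrt 2 * cotz z)) z'.
  by case: nz' => v vo hv; exists v => //; exact: le_trans qz.
have kB := cotz_lower_bound z0' nz'' h1 h2.
have ar := angle_ratio k0 k3.
have b0 : 0 <= atan (Num.sqrt 2 * cotz z)^-1.
  by rewrite -atan0 le_atan // invr_ge0 mulr_ge0 ?sqrtr_ge0 // ltW.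
have aB : - atan (Num.sqrt 2 * cotz z)^-1 <= atan (cotz z') by rewrite -atanN le_atan.
by apply: le_largest_angle => //; lra.
Qed.
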